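(* Let $X$ be a separable metrizable space. If $X$ is strongly indecomposable, then $X$ has a metrizable indecomposable compactification.
   Context: A topological space $X$ is strongly indecomposable if for every two non-empty disjoint open sets $U,V\subseteq X$ there are two closed sets $A,B\subseteq X$ such that $X=A\cup B$, $A\cap U\neq\varnothing$, $B\cap U\neq\varnothing$, and $A\cap B\subseteq V$. A topological space $Y$ (not assumed connected) is indecomposable if every connected subset of $Y$ is either dense or nowhere dense in $Y$. A compactification of $X$ is a compact Hausdorff space in which $X$ is densely embedded. *)

(* Defs.v *)
From HB Require Import structures.
From mathcomp Require Import all_boot all_order all_algebra.
From mathcomp Require Import all_classical all_reals.
From mathcomp Require Import topology.

Set Implicit Arguments.
Unset Strict Implicit.
Unset Printing Implicit Defensive.

Import Order.TTheory GRing.Theory Num.Theory.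
Local Open Scope classical_set_scope.
Local Open Scope ring_scope.

(* Nonnegativity of [d] follows from the four axioms, as in [isMetric]. *)
Definition is_metric (R : realType) (T : Type) (d : T -> T -> R) : Prop :=
  [/\ forall x, d x x = 0,
      forall x y, d x y = 0 -> x = y,
      forall x y, d x y = d y x &
      forall y x z, d x z <= d x y + d y z].

Definition metrizable (R : realType) (T : topologicalType) : Prop :=
  exists2 d : T -> T -> R, is_metric d &
    forall x : T, nbhs x = nbhs_ball_ (fun x e => [set y | d x y < e]) x.

Definition separable (T : topologicalType) : Prop :=
  exists2 D : set T, countable D & dense D.

Definition strongly_indecomposable (X : topologicalType) : Prop :=
  forall U V : set X, open U -> open V -> U !=set0 -> V !=set0 ->
    U `&` V = set0 ->
    exists A B : set X,
      [/\ closed A /\ closed B, [set: X] = A `|` B,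
          A `&` U !=set0, B `&` U !=set0 & A `&` B `<=` V].

Definition nowhere_dense (T : topologicalType) (A : set T) : Prop :=
  interior (closure A) = set0.

Definition indecomposable (Y : topologicalType) : Prop :=
  forall C : set Y, connected C -> dense C \/ nowhere_dense C.

(* [subspace (range f)] is the whole type [Y] with the points outside [range f]
   made isolated, so a subset of [range f] is open in it exactly when it is
   relatively open in [range f]. *)
Definition embedding (X Y : topologicalType) (f : X -> Y) : Prop :=
  [/\ injective f, continuous f &
      forall A : set X, open A -> open (f @` A : set (subspace (range f)))].

Definition compactification (X Y : topologicalType) (f : X -> Y) : Prop :=
  [/\ compact [set: Y], hausdorff_space Y, embedding f & dense (range f)].

(* Main.v *)
Require Import Defs.
From HB Require Import structures.
From mathcomp Require Import all_boot all_order all_algebra.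
From mathcomp Require Import all_classical all_reals.
From mathcomp Require Import interval_inference topology normedtype.
From mathcomp Require Import lra.

(** Strong indecomposability yields, for disjoint non-empty open sets [U] and
    [V], closed sets [A], [B] covering [X], both meeting [U], that overlap only
    inside [V].  Off [V] they are disjoint closed sets, so a continuous
    [f : X -> [0, 1]] vanishes on [A] off [V] and equals 1 on [B] off [V]: every
    value of [f] off [V] is 0 or 1, and both values are taken on [U].

    A compactification [Y] to which such an [f] extends as [h] cannot contain a
    connected set whose closure [K] includes [U] and misses the closure of [V]
    in [Y].  Indeed [Y] is covered by the fibres of [h] over 0 and 1 together
    with the closure of [V], because that closed union contains the dense image
    of [X]; hence [K] would be covered by the two disjoint closed fibres while
    meeting both.  If some connected set were neither dense nor nowhere dense,
    basic open sets [U], [V] of this kind would exist, by regularity of [Y];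
    so it is enough to extend the functions [f] attached to the countably many
    pairs of members of a countable base of [X].  This is
    [indecomposable_of_cuts].

    Countably many bounded functions can always be extended to one metrizable
    compactification: adjoin to them the functions of Urysohn's metrization
    theorem, which separate points from closed sets, and take for [Y] the
    closure of the image of [X] in the cube of all their values
    ([compactification_of_functions], [extending_compactification]).  The
    coordinates of the cube are the extensions.  A metric on [Y] comes from the
    general fact that a compact space with a separating sequence of continuous
    functions is metrizable ([compact_metrizable]). *)

Set Implicit Arguments.
Unset Strict Implicit.
Unset Printing Implicit Defensive.
Import Order.TTheory GRing.Theory Num.Theory.
Import numFieldNormedType.Exports.
Local Open Scope classical_set_scope.
Local Open Scope ring_scope.

(** * Metrizable spaces *)

(** A type synonym that carries the metric [d], with the topology generated by
    it, so that results on metric spaces can be applied to a space that is only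
    known to be metrizable. *)
Definition metric_copy (R : realType) (X : topologicalType) (d : X -> X -> R)
  (dm : is_metric d) : Type := X.

HB.instance Definition _ (R : realType) (X : topologicalType)
  (d : X -> X -> R) (dm : is_metric d) := Choice.copy (metric_copy dm) X.

HB.instance Definition _ (R : realType) (X : topologicalType)
    (d : X -> X -> R) (dm : is_metric d) :=
  @isMetric.Build R (metric_copy dm) d
    (let: And4 h _ _ _ := dm in h) (let: And4 _ h _ _ := dm in h)
    (let: And4 _ _ h _ := dm in h) (let: And4 _ _ _ h := dm in h).

Lemma metric_copy_open (R : realType) (X : topologicalType)
    (d : X -> X -> R) (dm : is_metric d) :
  (forall x : X, nbhs x = nbhs_ball_ (fun x e => [set y | d x y < e]) x) ->
  forall A : set X, open A <-> open (A : set (metric_copy dm)).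
Proof.
move=> nE.
have nbE (x : X) : nbhs x = nbhs (x : metric_copy dm).
  by rewrite nE -(congr1 (@^~ (x : metric_copy dm)) nbhs_ballE).
by move=> A; rewrite !openE /interior; split=> oA x Ax; have := oA x Ax;
  rewrite /= nbE.
Qed.

Lemma metrizable_normal (R : realType) (X : topologicalType) :
  metrizable R X -> normal_space X.
Proof.
move=> [d dm nE]; have oE := metric_copy_open dm nE.
have cE (A : set X) : closed A -> closed (A : set (metric_copy dm)).
  by rewrite -!openC => /oE.
apply/(@normal_openP R) => A B /cE cA /cE cB AB0.
have /(@normal_openP R) := @pseudometric_normal R (metric_copy dm).
move=> /(_ A B cA cB AB0) [U [V [/oE oU /oE oV AU BV UV0]]].
by exists U, V.
Qed.

Lemma metrizable_hausdorff (R : realType) (X : topologicalType) :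
  metrizable R X -> hausdorff_space X.
Proof.
move=> [d dm nE]; have oE := metric_copy_open dm nE.
have := @metric_hausdorff R (metric_copy dm).
rewrite !open_hausdorff => hM x y /hM [[A B] /= xyAB [/oE oA /oE oB AB0]].
by exists (A, B).
Qed.

(** The base consists of the balls of radius [1 / (k + 1)] centred at points of
    a countable dense set.  A centre is named through its code [g p], which makes
    the indexing total even if that dense set is empty. *)
Lemma separable_metrizable_base (R : realType) (X : topologicalType) :
  separable X -> metrizable R X ->
  exists2 W : nat -> set X, forall n, open (W n) &
    forall x U, nbhs x U -> exists2 n, W n x & W n `<=` U.
Proof.
move=> [D /countable_injP [g ginj] dD] [d [dxx _ dsym dtri] nE].
have nP (x : X) U : nbhs x U <-> exists2 e, 0 < e & [set y | d x y < e] `<=` U.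
  by rewrite nE.
have ball_open p r : open [set y | d p y < r].
  rewrite openE => x /= pxr; apply/nP; exists (r - d p x).
    by rewrite subr_gt0.
  move=> y /=; rewrite ltrBrDl; apply: le_lt_trans; exact: dtri.
pose W n : set X := if unpickle n is Some (m, k) then
  \bigcup_(p in [set p | D p /\ g p = m]) [set y | d p y < k.+1%:R^-1]
  else set0.
exists W => [n|x U /nP [e e0 xeU]].
  rewrite /W; case: (unpickle n) => [[m k]|]; last exact: open0.
  by apply: bigcup_open => p _; exact: ball_open.
have [k ke] : exists k, k.+1%:R^-1 < e / 2.
  have e20 : 0 < e / 2 by rewrite divr_gt0.
  by have [k _ /(_ k (leqnn k))] := near_infty_natSinv_lt (PosNum e20); exists k.
have [p [/= xp Dp]] : [set y | d x y < k.+1%:R^-1] `&` D !=set0.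
  by apply: dD => //; exists x; rewrite /= dxx.
have WE : W (pickle (g p, k)) = [set y | d p y < k.+1%:R^-1].
  rewrite /W pickleK; apply/seteqP; split=> [y [q [Dq gqp]] /=|y py].
    by rewrite (ginj q p) // inE.
  by exists p.
exists (pickle (g p, k)); rewrite WE /=; first by rewrite dsym.
move=> y /= py; apply: xeU => /=; rewrite (splitr e).
by apply: le_lt_trans (dtri p x y) _; rewrite ltrD // (lt_trans _ ke).
Qed.

(** The metric is the supremum over [n] of [|h n x - h n y| / (n + 1)].  Its
    balls are neighbourhoods because the weights reduce the supremum to finitely many
    coordinates.  Conversely, if the complement of a neighbourhood of [x] met
    all balls around [x], the traces of these balls on it would cluster at a
    point indistinguishable from [x] by every [h n], that is, at [x] itself. *)
Lemma compact_metrizable (R : realType) (Y : topologicalType)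
    (h : nat -> Y -> R) :
  compact [set: Y] -> (forall n, continuous (h n)) ->
  (forall n y, 0 <= h n y <= 1) ->
  (forall x y, (forall n, h n x = h n y) -> x = y) -> metrizable R Y.
Proof.
move=> cY hc h01 hsep.
pose t x y n := `|h n x - h n y| / n.+1%:R.
have n0 n : 0 < n.+1%:R :> R by [].
have t_le x y n : t x y n <= n.+1%:R^-1.
  rewrite /t ler_piMl ?invr_ge0 // ler_norml.
  have /andP[? ?] := h01 n x; have /andP[? ?] := h01 n y.
  by apply/andP; split; lra.
pose d x y := sup (range (t x y)).
have t_d x y n : t x y n <= d x y.
  apply: ub_le_sup; last by exists n.
  exists 1 => _ [m _ <-]; apply: le_trans (t_le _ _ _) _.
  by rewrite invf_le1 // ler1n.
have d_le x y e : (forall n, t x y n <= e) -> d x y <= e.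
  move=> te; apply: ge_sup; first by exists (t x y 0), 0.
  by move=> _ [n _ <-].
have dxx x : d x x = 0.
  apply/eqP; rewrite eq_le; apply/andP; split.
    by apply: d_le => n; rewrite /t subrr normr0 mul0r.
  by apply: le_trans (t_d x x 0%N); rewrite /t subrr normr0 mul0r.
have dE0 x y : d x y = 0 -> x = y.
  move=> dxy; apply: hsep => n; apply/eqP; rewrite -subr_eq0 -normr_le0.
  by have := t_d x y n; rewrite dxy /t pmulr_lle0 ?invr_gt0.
have dsym x y : d x y = d y x.
  rewrite /d (_ : t x y = t y x) //; apply/funext => n; by rewrite /t distrC.
have dtri y x z : d x z <= d x y + d y z.
  apply: d_le => n; apply: le_trans (lerD (t_d x y n) (t_d y z n)).
  by rewrite /t -mulrDl ler_pM2r ?invr_gt0 // ler_distD.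
have dnbhs x e : 0 < e -> nbhs x [set y | d x y < e].
  move=> e0; have e20 : 0 < e / 2 by rewrite divr_gt0.
  have [N _ Ne] := near_infty_natSinv_lt (PosNum e20).
  (* Beyond [N] the weight alone makes the term smaller than [e / 2]. *)
  have : \forall y \near x, forall n : 'I_N, `|h n x - h n y| < e / 2.
    apply: filter_forall => n.
    have := hc n x; move=> /cvgrPdist_lt /(_ _ e20); exact.
  apply: filterS => y yP /=; apply: (@le_lt_trans _ _ (e / 2)); last first.
    by rewrite ltr_pdivrMr // ltr_pMr // ltr1n.
  apply: d_le => n; case: (ltnP n N) => nN.
    apply: ltW; apply: le_lt_trans (yP (Ordinal nN)).
    by rewrite /t ler_pdivrMr // ler_peMr // ler1n.
  by apply: ltW; apply: le_lt_trans (t_le _ _ _) (Ne _ nN).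
exists d => // x; apply/seteqP; split=> U; last first.
  by move=> [e e0 /filterS]; apply; exact: dnbhs.
move=> xU; apply: contrapT => noball.
pose F := filter_from [set e : R | 0 < e]
  (fun e => [set y | d x y < e] `&` ~` U).
have FF : ProperFilter F.
  apply: filter_from_proper; last first.
    move=> e e0; apply: contrapT => nex; apply: noball; exists e => // y /= xy.
    by apply: contrapT => Uy; apply: nex; exists y.
  apply: filter_from_filter; first by exists 1 => /=.
  move=> e1 e2 /= e10 e20; exists (Num.min e1 e2).
    by rewrite /= lt_min e10.
  by move=> y [/=]; rewrite lt_min => /andP[? ?] ?.
have [y [_ yF]] := cY F FF filterT.
(* [F] contains the complement of [U], so it cannot cluster at [x]. *)
suff xy : x = y.
  have /yF : F ([set y | d x y < 1] `&` ~` U) by exists 1 => /=.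
  by rewrite -xy => /(_ _ xU) [z [[_ nUz] Uz]].
apply: hsep => n; apply/eqP; rewrite -subr_eq0 -normr_eq0.
apply/negPn/negP => xyn0.
have e0 : 0 < `|h n x - h n y| / 2 by rewrite divr_gt0 // lt_def xyn0 /=.
set e := `|h n x - h n y| / 2 in e0.
have FB : F ([set y | d x y < e / n.+1%:R] `&` ~` U).
  by exists (e / n.+1%:R) => //=; rewrite divr_gt0.
have := hc n y => /cvgrPdist_lt /(_ _ e0) yN.
have [z [[/= xz _] yz]] := yF _ _ FB yN.
have {}xz : `|h n x - h n z| < e.
  by rewrite -(@ltr_pM2r _ n.+1%:R^-1) ?invr_gt0 // (le_lt_trans (t_d _ _ _)).
have := ler_distD (h n z) (h n x) (h n y).
rewrite leNgt [`|h n x - h n y|](splitr _) => /negP; apply.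
by rewrite ltrD // distrC.
Qed.

(** * Compactifications extending countably many functions *)

Lemma compact_set_type (T : topologicalType) (K : set T) :
  compact K -> compact [set: K].
Proof.
move=> cK F FF _; pose G := fmap (set_val : K -> T) F.
have GK : G K by apply: (@filterE _ F) => y; exact: set_valP.
have [p [Kp Gp]] := cK G _ GK.
exists (exist _ p (mem_set Kp)); split => // A B FA [_ [[V oV <-] Vp] VB].
have GA : G (set_val @` A) by apply: (@filterS _ F _ A _ _ FA) => y Ay; exists y.
have [_ [[y Ay <-] Vy]] := Gp _ V GA (open_nbhs_nbhs (conj oV Vp)).
by exists y; split => //; exact: VB.
Qed.

(** The diagonal map of the family embeds [X] in a product of real lines; its
    image lies in a cube, whose compactness passes to the closure of the image.
    The coordinate functions extend the given ones, and they separate points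
    of the closure, which makes it metrizable. *)
Lemma compactification_of_functions (R : realType) (X : topologicalType)
    (f : nat -> X -> R) :
  accessible_space X -> (forall n, continuous (f n)) ->
  (forall n x, 0 <= f n x <= 1) -> separate_points_from_closed f ->
  exists (Y : topologicalType) (g : X -> Y),
    [/\ compactification g, metrizable R Y &
        forall n, exists2 h : Y -> R, continuous h & forall x, h (g x) = f n x].
Proof.
move=> X1 fc f01 fsep.
pose P := prod_topology (fun _ : nat => R : topologicalType).
pose j : X -> P := join_product f.
pose K : set P := closure (range j).
have jK x : j x \in K by rewrite inE; apply: subset_closure; exists x.
pose g x : K := exist _ (j x) (jK x).
pose h n (y : K) : R := (set_val y : P) n.
have vc : continuous (set_val : K -> P) by exact: initial_continuous.
have hc n : continuous (h n).
  move=> y; apply: (@continuous_comp _ _ _ (set_val : K -> P) (proj n)).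
    exact: vc.
  exact: proj_continuous.
have [Kbox cK] : (forall p, K p -> forall n, 0 <= p n <= 1) /\ compact K.
  pose B : set P := [set p | forall n, `[0, 1]%classic (p n)].
  have cB : compact B :=
    @tychonoff nat (fun=> R) (fun=> `[0, 1]%classic)
      (fun=> @segment_compact R 0 1).
  have clB : closed B.
    apply: compact_closed cB; apply: hausdorff_product => n.
    exact: norm_hausdorff.
  have KB : K `<=` B.
    rewrite (_ : B = closure B); last exact/closure_id.
    apply: closureS.
    by move=> _ [x _ <-] n /=; rewrite in_itv /=; exact: f01.
  split; last exact: (@subclosed_compact P K B (@closed_closure P _) cB KB).
  by move=> p /KB Bp n; have := Bp n; rewrite /= in_itv.
have cY : compact [set: K] by exact: compact_set_type.
have mY : metrizable R K.
  apply: (compact_metrizable cY hc).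
    by move=> n y; apply: Kbox; exact: set_valP.
  by move=> x y hxy; apply: val_inj; apply/funext => n; exact: hxy.
exists K, g; split => //; last by move=> n; exists (h n).
have jinj := join_product_inj fsep X1.
split => //; first exact: metrizable_hausdorff mY.
  split.
  - by move=> x y /(congr1 val) jxy; apply: jinj; rewrite ?inE.
  - apply: continuous_comp_initial; exact: join_product_continuous.
  - move=> A /(join_product_open fsep) /open_subspaceP [V oV VA].
    apply/open_subspaceP; exists (set_val @^-1` V); first by exists V.
    apply/seteqP; split=> [y [+ [x _ xy]]|_ [[x Ax <-] _]].
      rewrite -xy => Vy.
      split; last by exists x.
      have : (V `&` range j) (j x) by split => //; exists x.
      rewrite /j VA => -[[z Az jz] _].
      by exists z => //; congr (g _); apply: jinj; rewrite ?inE.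
    split; last by exists x.
    have : ([set j x | x in A] `&` range j) (j x) by split; exists x.
    by rewrite /j -VA => -[].
move=> O + [V oV VO]; rewrite -VO => -[y Vy].
have Vn : nbhs (set_val y) V by exact: open_nbhs_nbhs.
have [_ [[x _ <-] Vx]] := set_valP y V Vn.
by exists (g x); split => //; exists x.
Qed.

Lemma normal_urysohn (R : realType) (X : topologicalType) (A B : set X) :
  normal_space X -> closed A -> closed B -> A `&` B = set0 ->
  exists f : X -> R, [/\ continuous f, forall x, 0 <= f x <= 1,
    forall x, A x -> f x = 0 & forall x, B x -> f x = 1].
Proof.
move=> nX cA cB AB0.
have /(@uniform_separatorP _ R) [f [fc f01 fA fB]] :=
  normal_uniform_separator nX cA cB AB0.
exists f; split => // x => [|Ax|Bx].
- by have := f01 (f x) (ex_intro2 _ _ x I erefl); rewrite /= in_itv.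
- by apply: (fA (f x)); exists x.
- by apply: (fB (f x)); exists x.
Qed.

(** The functions to be extended need not separate points from closed sets, so
    they are joined by the functions [u (i, j)] that separate the closure of
    [W i] from the complement of [W j] whenever these are disjoint; normality
    makes such pairs fine enough to separate. *)
Lemma extending_compactification (R : realType) (X : topologicalType)
    (W : nat -> set X) (F : nat * nat -> X -> R) :
  normal_space X -> accessible_space X ->
  (forall n, open (W n)) ->
  (forall x U, nbhs x U -> exists2 n, W n x & W n `<=` U) ->
  (forall p, continuous (F p)) -> (forall p x, 0 <= F p x <= 1) ->
  exists (Y : topologicalType) (g : X -> Y),
    [/\ compactification g, metrizable R Y &
        forall p, exists2 h : Y -> R, continuous h & forall x, h (g x) = F p x].
Proof.
move=> nX X1 oW baseW Fc F01.
have /choice [u uP] : forall p : nat * nat, exists f : X -> R,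
    [/\ continuous f, forall x, 0 <= f x <= 1 &
        closure (W p.1) `<=` W p.2 ->
        forall x, (W p.1 x -> f x = 0) /\ (~ W p.2 x -> f x = 1)].
  move=> [i j] /=; have [Wij|nWij] := pselect (closure (W i) `<=` W j).
    have [||f [fc f01 f0 f1]] :=
        @normal_urysohn R X (closure (W i)) (~` W j) nX (@closed_closure _ _).
    - exact: open_closedC.
    - by apply/disjoints_subset; rewrite setCK.
    exists f; split => // _ x; split=> [Wx|]; last exact: f1.
    by apply: f0; exact: subset_closure.
  by exists (fun=> 0); split => // [x|x]; [exact: cvg_cst|rewrite lexx ler01].
pose G (q : bool * (nat * nat)) := if q.1 then u q.2 else F q.2.
have Gc q : continuous (G q).
  by case: q => -[] p; rewrite /G /=; [have [] := uP p|exact: Fc].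
have G01 q x : 0 <= G q x <= 1.
  by case: q => -[] p; rewrite /G /=; [have [] := uP p|exact: F01].
(* Indices that code no triple repeat an arbitrary member of the family. *)
pose f n := G (odflt (true, (0, 0)%N) (unpickle n)).
have fE q : f (pickle q) = G q by rewrite /f pickleK.
have fsep : separate_points_from_closed f.
  move=> U x cU nUx.
  (* [u (i, j)] will be 0 at [x] and 1 on [U]. *)
  have [j Wjx WjU] : exists2 j, W j x & W j `<=` ~` U.
    by apply: baseW; apply: open_nbhs_nbhs; split => //; exact: closed_openC.
  have /(@normal_openP R) /(_ [set x] (~` W j)) := nX.
  case=> [||| P [Q [oP oQ xP WQ PQ0]]].
  - exact: accessible_closed_set1.
  - exact: open_closedC.
  - by apply/disjoints_subset => _ ->; rewrite setCK.
  have [i Wix WiP] : exists2 i, W i x & W i `<=` P.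
    by apply: baseW; apply: open_nbhs_nbhs; split => //; exact: xP.
  have WijS : closure (W i) `<=` W j.
    have WiQ : closure (W i) `<=` ~` Q.
      rewrite (_ : ~` Q = closure (~` Q)).
        by apply: closureS; apply: subset_trans WiP _; exact/disjoints_subset.
      exact/closure_id/open_closedC.
    by apply: subset_trans WiQ _; rewrite -(setCK (W j)); exact: subsetC.
  have [_ _ /(_ WijS) uij] := uP (i, j).
  exists (pickle (true, (i, j))); rewrite fE /G /=.
  have -> : u (i, j) x = 0 by apply: (uij x).1.
  have u1 : closure (u (i, j) @` U) `<=` [set 1].
    rewrite [X in _ `<=` X](_ : _ = closure [set 1 : R]); last first.
      apply/closure_id; exact: closed_eq.
    apply: closureS => _ [y Uy <-]; apply: (uij y).2 => /WjU; exact.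
  by move=> /u1 /esym/eqP; rewrite oner_eq0.
have [Y [g [cg mY gP]]] :=
  compactification_of_functions (f := f) X1 (fun n => Gc _) (fun n => G01 _) fsep.
exists Y, g; split => // p; have [h hc hg] := gP (pickle (false, p)).
by exists h => // x; rewrite hg fE.
Qed.

(** * Indecomposability of the compactification *)

(** The function [h] cuts [W i] into two parts that can only be joined through
    [W j].  A connected set whose closure [K] contains a non-empty open set and
    misses another one leads to a contradiction: base sets [W i] and [W j] are chosen
    inside these open sets, the second with closure in [Y] disjoint from [K],
    and then [K] is separated by the fibres of [h] over 0 and 1. *)
Lemma indecomposable_of_cuts (R : realType) (X Y : topologicalType)
    (W : nat -> set X) (g : X -> Y) :
  compact [set: Y] -> hausdorff_space Y -> continuous g -> dense (range g) ->
  (forall x U, nbhs x U -> exists2 n, W n x & W n `<=` U) ->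
  (forall i j, W i !=set0 -> W j !=set0 -> W i `&` W j = set0 ->
    exists2 h : Y -> R, continuous h &
      [/\ exists2 a, W i a & h (g a) = 0, exists2 b, W i b & h (g b) = 1 &
          forall x, ~ W j x -> h (g x) = 0 \/ h (g x) = 1]) ->
  indecomposable Y.
Proof.
move=> cY hY gc gd baseW cutW C Cconn.
apply: contrapT => /not_orP [nd nnd].
have oV : open (~` closure C) by exact/closed_openC/closed_closure.
have [V V0 CV] : exists2 V : set Y, V° !=set0 & closure V `<=` ~` closure C.
  have [y nCy] : (~` closure C) !=set0.
    apply: contrapT => /nonemptyPn C0.
    have CT : closure C = setT by rewrite -(setCK (closure C)) C0 setC0.
    apply: nd => O [z Oz] oO.
    have Cz : closure C z by rewrite CT.
    have [w [Cw Ow]] := Cz _ (open_nbhs_nbhs (conj oO Oz)).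
    by exists w.
  have [V yV VC] := @compact_regular Y y setT hY cY filterT (~` closure C)
    (open_nbhs_nbhs (conj oV nCy)).
  by exists V => //; exists y.
have U0 : (closure C)° !=set0 by apply/set0P/eqP.
(* Density of the image puts a member of the base inside every such [O]. *)
have pull (O : set Y) : O° !=set0 -> exists2 n, W n !=set0 & W n `<=` g @^-1` O.
  move=> O0; have [z [Og [x _ xE]]] := gd _ O0 (@open_interior _ _).
  rewrite -xE in Og; have [n Wx WO] := baseW x (g @^-1` O) (gc x _ Og).
  by exists n => //; exists x.
have [i Wi0 WiC] := pull (closure C) U0.
have [j Wj0 WjV] := pull V V0.
have Wij0 : W i `&` W j = set0.
  rewrite -subset0 => x [/WiC Cx /WjV Vx].
  exact: (CV (g x) (@subset_closure _ V _ Vx)).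
have [h hc [[a Wa ha] [b Wb hb] hout]] := cutW i j Wi0 Wj0 Wij0.
have hcl r : closed (h @^-1` [set r]).
  by apply: preimage_closed; [move=> y _; exact: hc|exact: closed_eq].
(* [S] is closed and contains the dense image of [X], hence it is all of [Y]. *)
pose S := h @^-1` [set 0] `|` h @^-1` [set 1] `|` closure V.
have ST y : S y.
  apply: contrapT => nSy.
  have oS : open (~` S).
    apply: closed_openC; apply: closedU; last exact: closed_closure.
    by apply: closedU; exact: hcl.
  have [z [nSx [x _ xE]]] := gd _ (ex_intro _ y nSy) oS.
  apply: nSx; rewrite -xE; have [/WjV Wx|/hout hx] := pselect (W j x).
    by right; exact: subset_closure.
  by left.
have Csub : closure C `<=` h @^-1` [set 0] `|` h @^-1` [set 1].
  by move=> y Cy; have [//|/CV] := ST y.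
have sep : separated (h @^-1` [set 0]) (h @^-1` [set 1]).
  rewrite /separated -!(iffLR (closure_id _) (hcl _)).
  suff -> : h @^-1` [set 0] `&` h @^-1` [set 1] = set0 by [].
  by rewrite -subset0 => y /= [-> /esym/eqP]; rewrite oner_eq0.
have [C0|C1] := connected_subset sep Csub (connected_closure Cconn).
- by have := C0 _ (WiC _ Wb); rewrite /= hb => /eqP; rewrite oner_eq0.
- by have := C1 _ (WiC _ Wa); rewrite /= ha => /esym/eqP; rewrite oner_eq0.
Qed.

Theorem theorem9 (R : realType) (X : topologicalType) :
  separable X -> metrizable R X -> strongly_indecomposable X ->
  exists (Y : topologicalType) (f : X -> Y),
    [/\ compactification f, metrizable R Y & indecomposable Y].
Proof.
move=> sX mX iX.
have nX := metrizable_normal mX.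
have X1 := hausdorff_accessible (metrizable_hausdorff mX).
have [W oW baseW] := separable_metrizable_base sX mX.
have /choice [F FP] : forall p : nat * nat, exists f : X -> R,
    [/\ continuous f, forall x, 0 <= f x <= 1 &
      W p.1 !=set0 -> W p.2 !=set0 -> W p.1 `&` W p.2 = set0 ->
      [/\ exists2 a, W p.1 a & f a = 0, exists2 b, W p.1 b & f b = 1 &
          forall x, ~ W p.2 x -> f x = 0 \/ f x = 1]].
  move=> [i j] /=.
  have [[Wi0 Wj0 Wij]|no] :=
      pselect [/\ W i !=set0, W j !=set0 & W i `&` W j = set0]; last first.
    exists (fun=> 0); split=> [x|x|? ? ?]; first exact: cvg_cst.
      by rewrite lexx ler01.
    by case: no.
  have [A [B [[cA cB] AB [a [Aa Wa]] [b [Bb Wb]] ABW]]] :=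
    iX _ _ (oW i) (oW j) Wi0 Wj0 Wij.
  have Wout x : W i x -> ~ W j x.
    by move=> Wix Wjx; rewrite -[False]/(set0 x) -Wij.
  (* [A] and [B] overlap only inside [W j]: off [W j] they are disjoint. *)
  have [|||f [fc f01 f0 f1]] :=
    @normal_urysohn R X (A `&` ~` W j) (B `&` ~` W j) nX.
  - by apply: closedI => //; exact: open_closedC.
  - by apply: closedI => //; exact: open_closedC.
  - by rewrite -subset0 => x [[Ax nWx] [Bx _]]; apply: nWx; exact: ABW.
  exists f; split => // _ _ _; split.
  - by exists a => //; apply: f0; split => //; exact: Wout.
  - by exists b => //; apply: f1; split => //; exact: Wout.
  move=> x nWx; have : (A `|` B) x by rewrite -AB.
  by case=> ?; [left; apply: f0|right; apply: f1].
have [Y [g [cg mY gP]]] := @extending_compactification R X W F nX X1 oW baseW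
  (fun p => let: And3 h _ _ := FP p in h) (fun p => let: And3 _ h _ := FP p in h).
exists Y, g; split => //.
have [cY hY [_ gc _] gd] := cg.
apply: (indecomposable_of_cuts cY hY gc gd baseW (R := R)) => i j Wi0 Wj0 Wij.
have [h hc hg] := gP (i, j); have [_ _ /(_ Wi0 Wj0 Wij)] := FP (i, j).
move=> [[a Wa fa] [b Wb fb] fout]; exists h => //; split.
- by exists a => //; rewrite hg.
- by exists b => //; rewrite hg.
- by move=> x /fout; rewrite hg.
Qed.
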